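(* $\mathbf{FewP}\subseteq\mathbf{MNP}$.
   Context: For a polynomial $p$, a polynomial-time computable predicate $R$ and input $x$, write $N(x)=|\{y : |y|=p(|x|)\wedge R(x,y)\}|$. A language $L$ is in $\mathbf{FewP}$ if there exist polynomials $p,q$ and a polynomial-time predicate $R$ such that for all $x$: if $x\in L$ then $1\le N(x)\le q(|x|)$, and if $x\notin L$ then $N(x)=0$. A language $L$ is in $\mathbf{MNP}$ if there exist a polynomial $p$ and a polynomial-time predicate $R$ such that for all $x$: if $x\in L$ then $N(x)=2^t-1$ for some $t\in\{1,2,3,\dots\}$, and if $x\notin L$ then $N(x)=0$. *)

(* Defs.v *)
From HB Require Import structures.
From mathcomp Require Import all_boot all_order all_algebra.

Set Implicit Arguments.
Unset Strict Implicit.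
Unset Printing Implicit Defensive.

Import GRing.Theory.

(* A tape cell is blank ([None]), an input symbol ([inl]) or an auxiliary
   work symbol ([inr]). *)
Definition cell (Sigma Gamma : finType) : finType := option (Sigma + Gamma)%type.

Inductive move : Set := MoveLeft | Stay | MoveRight.

(* A deterministic multi-tape Turing machine with [ntapes.+1] tapes; tape [ord0] receives the input.  A state [q]
   is halting iff [verdict q] is [Some b], with [b] telling whether the
   machine accepts. *)
Record machine (Sigma : finType) : Type := Machine {
  ntapes : nat;
  work : finType;
  state : finType;
  start : state;
  verdict : state -> option bool;
  delta : state -> {ffun 'I_ntapes.+1 -> cell Sigma work} ->
          state * {ffun 'I_ntapes.+1 -> cell Sigma work * move}
}.

(* Two-way infinite tapes, indexed relatively to the head: [t 0] is the
   scanned cell, so moving the head shifts the contents. *)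
Definition tape (Sigma Gamma : finType) : Type := int -> cell Sigma Gamma.

Definition tape_write (Sigma Gamma : finType) (c : cell Sigma Gamma)
    (t : tape Sigma Gamma) : tape Sigma Gamma :=
  fun i => if i == 0%R then c else t i.

Definition tape_move (Sigma Gamma : finType) (m : move)
    (t : tape Sigma Gamma) : tape Sigma Gamma :=
  match m with
  | MoveLeft => fun i => t (i - 1)%R
  | Stay => t
  | MoveRight => fun i => t (i + 1)%R
  end.

Definition blank_tape (Sigma Gamma : finType) : tape Sigma Gamma :=
  fun=> None.

Definition input_tape (Sigma Gamma : finType) (w : seq Sigma) :
    tape Sigma Gamma :=
  fun i => if i is Posz n then nth None [seq Some (inl a) | a <- w] n else None.

Definition config (Sigma : finType) (M : machine Sigma) : Type :=
  (state M * {ffun 'I_(ntapes M).+1 -> tape Sigma (work M)})%type.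

Definition init (Sigma : finType) (M : machine Sigma) (w : seq Sigma) :
    config M :=
  (start M, [ffun i => if i == ord0 then input_tape (work M) w
                       else blank_tape Sigma (work M)]).

(* Halted configurations are left unchanged. *)
Definition step (Sigma : finType) (M : machine Sigma) (c : config M) :
    config M :=
  if verdict c.1 is Some _ then c else
  let: (q, a) := delta c.1 [ffun i => c.2 i 0%R] in
  (q, [ffun i => tape_move (a i).2 (tape_write (a i).1 (c.2 i))]).

Definition halts_with (Sigma : finType) (M : machine Sigma) (w : seq Sigma)
    (n : nat) (b : bool) : Prop :=
  verdict (iter n (@step Sigma M) (init M w)).1 = Some b.

Definition bitstring : Type := seq bool.

Definition language : Type := bitstring -> Prop.

(* The pair (x, y) is written x#y, where [None] is the separator #. *)
Definition pair_code (x y : bitstring) : seq (option bool) :=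
  map Some x ++ None :: map Some y.

Definition polytime_predicate (R : bitstring -> bitstring -> bool) : Prop :=
  exists (M : machine (option bool)) (t : {poly nat}), forall x y : bitstring,
    halts_with M (pair_code x y) t.[size (pair_code x y)]%R (R x y).

Definition num_witnesses (p : {poly nat}) (R : bitstring -> bitstring -> bool)
    (x : bitstring) : nat :=
  #|[set y : (p.[size x]%R).-tuple bool | R x y]|.

Definition FewP (L : language) : Prop :=
  exists (p q : {poly nat}) (R : bitstring -> bitstring -> bool),
    polytime_predicate R /\
    forall x : bitstring,
      (L x -> 1 <= num_witnesses p R x <= q.[size x]%R) /\
      (~ L x -> num_witnesses p R x = 0).

Definition MNP (L : language) : Prop :=
  exists (p : {poly nat}) (R : bitstring -> bitstring -> bool),
    polytime_predicate R /\
    forall x : bitstring,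
      (L x -> exists2 t : nat, 1 <= t & num_witnesses p R x = 2 ^ t - 1) /\
      (~ L x -> num_witnesses p R x = 0).

(* Main.v *)
(* A set of N <= q(|x|) witnesses has 2^N - 1 nonempty subsets, so it suffices
   that a polynomial-time predicate accepts exactly one string of a fixed length
   per nonempty set of witnesses.  A subset is written as its elements in
   strictly increasing lexicographic order, the last one being repeated until
   there are k blocks.

   The new verifier need not compute p(|x|): a candidate has the form
     1^a 0^c 1 (d_1 0^c) ... (d_k 0^c) 0^a   with |d_i| = a, k = a + c, c > 0,
   where the header serves as a ruler for the blocks and as a counter for their
   number.  Its length k^2 + k + 1 + a with a < k determines a and c, so fixing the
   length for a = p(|x|) and c = q(|x|) + 1 forces these values.  The given
   machine is simulated on each block in turn, erasing its tapes in between. *)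

Require Import Defs.
From HB Require Import structures.
From mathcomp Require Import all_boot all_order all_algebra zify.
From Stdlib Require Import FunctionalExtensionality.

Set Implicit Arguments.
Unset Strict Implicit.
Unset Printing Implicit Defensive.

Import GRing.Theory.

(** * Tapes as zippers *)

Section Tapes.
Variables Sigma Gamma : finType.
Notation symbol := (cell Sigma Gamma).
Implicit Types (l r : seq symbol) (t : tape Sigma Gamma) (c : symbol).

(* [l] is read leftwards from the head, [r] rightwards from the scanned cell. *)
Definition zipper l r : tape Sigma Gamma := fun i =>
  match i with Posz n => nth None r n | Negz n => nth None l n end.

Definition act (a : symbol * move) t : tape Sigma Gamma :=
  tape_move a.2 (tape_write a.1 t).

Lemma zipper0 l r : zipper l r 0%R = head None r.
Proof. by rewrite -nth0. Qed.

Lemma zipper_eq l1 r1 l2 r2 :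
    nth None l1 =1 nth None l2 -> nth None r1 =1 nth None r2 ->
  zipper l1 r1 = zipper l2 r2.
Proof. by move=> el er; apply: functional_extensionality; case=> n /=. Qed.

Lemma zipper_blank : zipper [::] [::] = blank_tape Sigma Gamma.
Proof. by apply: functional_extensionality; case=> n /=; rewrite nth_nil. Qed.

Lemma zipper_left_blank r : zipper [:: None] r = zipper [::] r.
Proof. by apply: zipper_eq => // -[|[]]. Qed.

(** Writing back the scanned symbol makes the blank beyond the end of an empty [r] explicit; the
    tape is the same. *)
Lemma zipper_head_behead l r r' :
  zipper l (r' ++ head None r :: behead r) = zipper l (r' ++ r).
Proof.
apply: zipper_eq => // n; case: r => [|//] /=.
rewrite cats0 nth_cat; case: ltnP => // le; rewrite (nth_default _ le).
by case: (n - _) => [|[]].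
Qed.

Lemma act_stay t : act (t 0%R, Stay) t = t.
Proof.
apply: functional_extensionality => i; rewrite /act /= /tape_write.
by case: eqP => // ->.
Qed.

Lemma act_stay_zipper l r : act (head None r, Stay) (zipper l r) = zipper l r.
Proof. by rewrite -{1}(zipper0 l r) act_stay. Qed.

Lemma act_write l r c : act (c, Stay) (zipper l r) = zipper l (c :: behead r).
Proof.
apply: functional_extensionality; case=> [[|n]|n];
  rewrite /act /= /tape_write //.
by rewrite nth_behead.
Qed.

Lemma act_right l r c :
  act (c, MoveRight) (zipper l r) = zipper (c :: l) (behead r).
Proof.
apply: functional_extensionality; case=> [n|[|n]]; rewrite /act /= /tape_write.
- have -> : (Posz n + 1 = Posz n.+1)%R by lia.
  by rewrite /= nth_behead.
- by have -> : (Negz 0 + 1 = 0)%R by lia.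
by have -> : (Negz n.+1 + 1 = Negz n)%R by lia.
Qed.

Lemma act_left l r c : act (c, MoveLeft) (zipper l r) =
  zipper (behead l) (head None l :: c :: behead r).
Proof.
apply: functional_extensionality; case=> [[|[|n]]|n];
  rewrite /act /= /tape_write.
- have -> : (0 - 1 = Negz 0)%R by lia.
  by rewrite /= nth0.
- by have -> : (1%:Z - 1 = 0)%R by lia.
- have -> : (Posz n.+2 - 1 = Posz n.+1)%R by lia.
  by rewrite /= nth_behead.
have -> : (Negz n - 1 = Negz n.+1)%R by lia.
by rewrite /= nth_behead.
Qed.

Lemma input_tapeE (w : seq Sigma) :
  input_tape Gamma w = zipper [::] [seq Some (inl a) | a <- w].
Proof. by apply: functional_extensionality; case=> n //=; rewrite nth_nil. Qed.

End Tapes.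

Arguments zipper : simpl never.
Arguments act : simpl never.

(** * Running time bounds *)

Section Decides.
Variables (Sigma : finType) (M : machine Sigma).
Implicit Types c : config M.

Definition decides n c (b : bool) : Prop :=
  verdict (iter n (@step _ M) c).1 = Some b.

(** Phrased through verdicts instead of equality after [k] steps: since halted configurations are
    stationary, [k] can be replaced by any upper bound, and the phases need not be timed exactly. *)
Definition leads k c c' : Prop :=
  forall n b, decides n c' b -> decides (k + n) c b.

Lemma step_halted c b : verdict c.1 = Some b -> step c = c.
Proof. by rewrite /step => ->. Qed.

Lemma decides_le n m c b : n <= m -> decides n c b -> decides m c b.
Proof.
move=> /subnK <-; rewrite /decides iterD => h.
by elim: (m - n) => //= k ih; rewrite (step_halted ih).
Qed.

Lemma decides_halted n c b b' :
  verdict c.1 = Some b -> decides n c b' -> b = b'.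
Proof.
move=> h; have /(decides_le (leq0n n)): decides 0 c b by [].
by rewrite /decides => -> [].
Qed.

Lemma decidesS n c b : decides n.+1 c b = decides n (step c) b.
Proof. by rewrite /decides iterSr. Qed.

Lemma decides_via k n c c' b :
  leads k c c' -> k <= n -> decides (n - k) c' b -> decides n c b.
Proof. by move=> h le /h; rewrite subnKC. Qed.

Lemma leadsS k c c' : leads k (step c) c' -> leads k.+1 c c'.
Proof. by move=> h n b /h; rewrite /decides addSn iterSr. Qed.

Lemma leads1 c c' : step c = c' -> leads 1 c c'.
Proof. by move=> <-; apply: leadsS. Qed.

Lemma leads_trans k1 k2 c1 c2 c3 :
  leads k1 c1 c2 -> leads k2 c2 c3 -> leads (k1 + k2) c1 c3.
Proof. by move=> h1 h2 n b /h2 /h1; rewrite addnA. Qed.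

Lemma leads_le k k' c c' : k <= k' -> leads k c c' -> leads k' c c'.
Proof. by move=> le h n b /h; apply: decides_le; rewrite leq_add2r. Qed.

End Decides.

Arguments decides : simpl never.

(** * The verifier *)

(** The phase to enter after a rewind: a rewind takes place after the header, after reading a block
    and after an accepting simulation. *)
Variant return_point := ToNext | ToRun | ToErase.

Variant phase :=
  CopyX | Head1 | Head2 | Back of return_point | Rewind of return_point
| CopyIn | Data | Pad | Run | Erase | Next | Tail | Done of bool.

(** Serves to make [phase] a finite type, through its position in [phase_list]. *)
Definition phase_code (p : phase) : nat :=
  match p with
  | CopyX => 0 | Head1 => 1 | Head2 => 2
  | Back ToNext => 3 | Back ToRun => 4 | Back ToErase => 5
  | Rewind ToNext => 6 | Rewind ToRun => 7 | Rewind ToErase => 8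
  | CopyIn => 9 | Data => 10 | Pad => 11 | Run => 12 | Erase => 13
  | Next => 14 | Tail => 15 | Done true => 16 | Done false => 17
  end.

Definition phase_list :=
  [:: CopyX; Head1; Head2; Back ToNext; Back ToRun; Back ToErase;
      Rewind ToNext; Rewind ToRun; Rewind ToErase; CopyIn; Data; Pad; Run;
      Erase; Next; Tail; Done true; Done false].

Definition phase_ord (p : phase) : 'I_18 := inord (phase_code p).

Lemma phase_ordK : cancel phase_ord (fun i => nth CopyX phase_list i).
Proof. by case=> [|||[]|[]||||||||[]]; rewrite /= inordK. Qed.

HB.instance Definition _ := Countable.copy phase (can_type phase_ordK).
HB.instance Definition _ : isFinite phase := CanIsFinite phase_ordK.

Section Verifier.
Variable M : machine (option bool).

Notation mtape := 'I_(ntapes M).+1.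
Notation vwork := (cell (option bool) (work M)).
Notation symbol := (cell (option bool) vwork).
Notation vtape := (tape (option bool) vwork).

Definition bit (b : bool) : symbol := Some (inl (Some b)).

(* The cells written by the simulated machine are never blank, so that the
   region it visited can be found and erased afterwards. *)
Definition visited (a : cell (option bool) (work M)) : symbol := Some (inr a).

(** The simulated input is laid out as plain symbols, so both these and [visited] cells have to be
    understood. *)
Definition decode (u : symbol) : cell (option bool) (work M) :=
  match u with
  | None => None
  | Some (inl a) => Some (inl a)
  | Some (inr a) => a
  end.

(* Phase, whether two consecutive blocks were equal, comparison of the current
   block with the previous one, state of the simulated machine. *)
Definition control : finType := (phase * bool * option bool * state M)%type.

(** [None] stands for equality so far, [Some true] for a larger current block; the first difference
    decides. An exhausted previous block counts as smaller, which lets the first block pass the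
    order test. *)
Definition compare_bit (o : option bool) (p : option bool) (b : bool) :=
  if o is Some _ then o
  else if p is Some p' then (if p' == b then None else Some b) else Some true.

Definition bit_of (u : symbol) : option bool :=
  if u is Some (inl a) then a else None.

(* Besides the input tape and the tapes of [M]: X holds x#, V the ruler 1^a 0^c,
   W counts the remaining blocks and B holds the previous block. *)
Record actions := Actions {
  goto : control;
  on_in : symbol * move;
  on_X : symbol * move;
  on_V : symbol * move;
  on_W : symbol * move;
  on_B : symbol * move;
  on_M : mtape -> symbol * move
}.

(** Stopping on a blank lets a short tape wait for the longer ones, as all of them are treated in
    parallel. *)
Definition retreat (u : symbol) : symbol * move :=
  (u, if u is None then Stay else MoveLeft).

Definition erase (u : symbol) : symbol * move :=
  (None, if u is None then Stay else MoveRight).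

Definition resume (p : return_point) (e : bool) (o : option bool) (q : state M)
    : control :=
  match p with
  | ToNext => (Next, e, o, q)
  | ToRun => (Run, e, o, start M)
  | ToErase => (Erase, e, o, q)
  end.

(** In [Pad], a block equal to its predecessor raises the flag, and a larger one passes only while
    the flag is down, so repetitions occur only at the end. On acceptance [Run] marks the scanned
    cells, so that no unmarked cell separates a head from the region to be erased. *)
Definition transition (s : control) (u0 uX uV uW uB : symbol)
    (u : mtape -> symbol) : actions :=
  let: (ph, e, o, q) := s in
  let idle j := (u j, Stay) in
  let still s' := Actions s' (u0, Stay) (uX, Stay) (uV, Stay) (uW, Stay)
                             (uB, Stay) idle in
  let reject := still (Done false, e, o, q) in
  match ph with
  | CopyX =>
      if u0 is Some (inl a) then
        Actions (if a is Some _ then CopyX else Head1, e, o, q)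
          (u0, MoveRight) (u0, MoveRight) (uV, Stay) (uW, Stay) (uB, Stay) idle
      else reject
  | Head1 =>
      if bit_of u0 is Some b then
        Actions (if b then Head1 else Head2, e, o, q)
          (u0, MoveRight) (uX, Stay) (bit b, MoveRight) (bit true, MoveRight)
          (uB, Stay) idle
      else reject
  | Head2 =>
      match bit_of u0 with
      | Some false =>
          Actions (Head2, e, o, q) (u0, MoveRight) (uX, Stay)
            (bit false, MoveRight) (bit true, MoveRight) (uB, Stay) idle
      | Some true =>
          Actions (Back ToNext, e, o, q) (u0, MoveRight) (uX, Stay)
            (uV, Stay) (uW, MoveLeft) (uB, Stay) idle
      | None => reject
      end
  | Back p =>
      Actions (Rewind p, e, o, q) (u0, Stay) (uX, MoveLeft) (uV, MoveLeft)
        (uW, Stay) (uB, MoveLeft) (fun j => (u j, MoveLeft))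
  | Rewind p =>
      if [&& ~~ isSome uX, ~~ isSome uV, ~~ isSome uB &
             [forall j, ~~ isSome (u j)]] then
        Actions (resume p e o q) (u0, Stay) (uX, MoveRight) (uV, MoveRight)
          (uW, Stay) (uB, MoveRight) (fun j => (u j, MoveRight))
      else
        Actions s (u0, Stay) (retreat uX) (retreat uV) (uW, Stay) (retreat uB)
          (fun j => retreat (u j))
  | CopyIn =>
      if isSome uX then
        Actions s (u0, Stay) (uX, MoveRight) (uV, Stay) (uW, Stay) (uB, Stay)
          (fun j => if j == ord0 then (uX, MoveRight) else (u j, Stay))
      else still (Data, e, None, q)
  | Data =>
      if bit_of uV is Some true then
        if bit_of u0 is Some b then
          Actions (Data, e, compare_bit o (bit_of uB) b, q)
            (u0, MoveRight) (uX, Stay) (uV, MoveRight) (uW, Stay)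
            (bit b, MoveRight)
            (fun j => if j == ord0 then (bit b, MoveRight) else (u j, Stay))
        else reject
      else still (Pad, e, o, q)
  | Pad =>
      if isSome uV then
        if bit_of u0 is Some false then
          Actions s (u0, MoveRight) (uX, Stay) (uV, MoveRight) (uW, Stay)
            (uB, Stay) idle
        else reject
      else
        match o with
        | None => still (Back ToRun, true, o, q)
        | Some b =>
            if b && ~~ e then still (Back ToRun, false, o, q) else reject
        end
  | Run =>
      match verdict q with
      | Some true =>
          Actions (Back ToErase, e, o, q) (u0, Stay) (uX, Stay) (uV, Stay)
            (uW, Stay) (uB, Stay) (fun=> (visited None, Stay))
      | Some false => reject
      | None =>
          let: (q', a) := delta q [ffun j => decode (u j)] in
          Actions (Run, e, o, q') (u0, Stay) (uX, Stay) (uV, Stay) (uW, Stay)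
            (uB, Stay) (fun j => (visited (a j).1, (a j).2))
      end
  | Erase =>
      if [forall j, ~~ isSome (u j)] then
        Actions (Next, e, o, q) (u0, Stay) (uX, Stay) (uV, Stay) (uW, MoveLeft)
          (uB, Stay) idle
      else
        Actions s (u0, Stay) (uX, Stay) (uV, Stay) (uW, Stay) (uB, Stay)
          (fun j => erase (u j))
  | Next => still (if isSome uW then CopyIn else Tail, e, o, q)
  | Tail =>
      if bit_of uV is Some true then
        if bit_of u0 is Some false then
          Actions s (u0, MoveRight) (uX, Stay) (uV, MoveRight) (uW, Stay)
            (uB, Stay) idle
        else reject
      else still (Done (~~ isSome u0), e, o, q)
  | Done _ => reject
  end.

Definition vtapes := 5 + (ntapes M).+1.

Definition assemble (T : Type) (z a0 aX aV aW aB : T) (g : mtape -> T)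
    (i : 'I_vtapes) : T :=
  match split i with
  | inl j => nth z [:: a0; aX; aV; aW; aB] j
  | inr j => g j
  end.

Definition fixed_tape (k : 'I_5) : 'I_vtapes := lshift (ntapes M).+1 k.

Definition verifier_delta (s : control)
    (f : {ffun 'I_vtapes -> symbol}) :
    control * {ffun 'I_vtapes -> symbol * move} :=
  let r := transition s (f (fixed_tape (inord 0))) (f (fixed_tape (inord 1)))
    (f (fixed_tape (inord 2))) (f (fixed_tape (inord 3)))
    (f (fixed_tape (inord 4))) (fun j => f (rshift 5 j)) in
  (goto r, finfun (assemble (None, Stay) (on_in r) (on_X r) (on_V r) (on_W r)
                            (on_B r) (on_M r))).

(** A machine has one tape more than its field [ntapes], hence 4 where [vtapes] has 5. *)
Definition verifier : machine (option bool) :=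
  @Machine (option bool) (4 + (ntapes M).+1) vwork control
    (CopyX, false, None, start M)
    (fun s => if s.1.1.1 is Done b then Some b else None)
    verifier_delta.

Definition conf (s : control) (t0 tX tV tW tB : vtape) (g : mtape -> vtape) :
    config verifier :=
  (s, finfun (assemble (blank_tape _ _) t0 tX tV tW tB g)).

Lemma split_fixed_tape k : split (fixed_tape k) = inl k.
Proof. exact: (unsplitK (inl k)). Qed.

Lemma init_conf w : init verifier w =
  conf (CopyX, false, None, start M) (zipper [::] [seq Some (inl a) | a <- w])
    (zipper [::] [::]) (zipper [::] [::]) (zipper [::] [::]) (zipper [::] [::])
    (fun=> zipper [::] [::]).
Proof.
rewrite /init /conf; congr pair; apply/ffunP => i; rewrite !ffunE /assemble.
rewrite !zipper_blank -input_tapeE.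
case: (@splitP 5 (ntapes M).+1 i) => j ej.
  rewrite -(inj_eq val_inj) /= ej; case: j {ej} => [[|k] lt] //=.
  by case: k lt => [|[|[|[]]]].
by rewrite -(inj_eq val_inj) /= ej.
Qed.

(** Reduces a step to independent actions on zippers; the phase lemmas are inductions that rewrite
    with it. *)
Lemma step_conf s t0 tX tV tW tB g : verdict (m := verifier) s = None ->
  step (conf s t0 tX tV tW tB g) =
  let r := transition s (t0 0%R) (tX 0%R) (tV 0%R) (tW 0%R) (tB 0%R)
                      (fun j => g j 0%R) in
  conf (goto r) (act (on_in r) t0) (act (on_X r) tX) (act (on_V r) tV)
    (act (on_W r) tW) (act (on_B r) tB) (fun j => act (on_M r j) (g j)).
Proof.
rewrite /step [(conf _ _ _ _ _ _ _).1]/= => -> /=.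
rewrite /verifier_delta.
set r := transition _ _ _ _ _ _ _; set r' := transition _ _ _ _ _ _ _.
have -> : r = r'.
  rewrite /r /r' !ffunE /assemble !split_fixed_tape !inordK //=.
  congr transition; apply: functional_extensionality => j.
  by rewrite !ffunE (unsplitK (inr j)).
congr pair; apply/ffunP => i; rewrite !ffunE /assemble.
case: (@split 5 (ntapes M).+1 i) => j //; case: j => [[|[|[|[|[|k]]]]] lt] //.
Qed.

End Verifier.

(** * Behaviour of the phases *)

Section VerifierPhases.
Variable M : machine (option bool).

Notation mtape := 'I_(ntapes M).+1.
Notation vwork := (cell (option bool) (work M)).
Notation symbol := (cell (option bool) vwork).
Notation vtape := (tape (option bool) vwork).
Notation blank := (zipper [::] [::] : vtape).
Notation bit := (bit M).
Notation conf := (@conf M).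

Implicit Types (e : bool) (o : option bool) (q : state M) (l r : seq symbol)
  (t : vtape) (g : mtape -> vtape).

Definition input_only t : mtape -> vtape :=
  fun j => if j == ord0 then t else blank.

Lemma input_only_blank : input_only blank = fun=> blank.
Proof.
by apply: functional_extensionality => j; rewrite /input_only if_same.
Qed.

Lemma act_idle g : (fun j => act (g j 0%R, Stay) (g j)) = g.
Proof. by apply: functional_extensionality => j; rewrite act_stay. Qed.

Lemma act_input_only t a :
  (fun j => act (if j == ord0 then a else (input_only t j 0%R, Stay))
                (input_only t j)) = input_only (act a t).
Proof.
apply: functional_extensionality => j; rewrite /input_only.
by case: eqP => _ //; rewrite act_stay.
Qed.

Let stepE := (zipper0, act_stay_zipper, act_stay, act_idle, act_right, act_left,
              act_write, act_input_only).

Lemma decides_Done k b e o q t0 tX tV tW tB g :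
  decides k (conf (Done b, e, o, q) t0 tX tV tW tB g) b.
Proof. exact: (@decides_le _ _ 0). Qed.

Lemma CopyX_leads x y l lX e o q tV tW tB g :
  leads (size x).+1
    (conf (CopyX, e, o, q) (zipper l [seq Some (inl a) | a <- pair_code x y])
       (zipper lX [::]) tV tW tB g)
    (conf (Head1, e, o, q)
       (zipper (Some (inl None) :: catrev (map bit x) l) (map bit y))
       (zipper (Some (inl None) :: catrev (map bit x) lX) [::]) tV tW tB g).
Proof.
elim: x l lX => [|b x ih] l lX; apply: leadsS; rewrite step_conf //= !stepE.
  by rewrite -map_comp.
exact: ih.
Qed.

Lemma Head1_leads a y l v w e o q tX tB g :
  leads a.+1
    (conf (Head1, e, o, q) (zipper l (map bit (nseq a true ++ false :: y)))
       tX (zipper v [::]) (zipper w [::]) tB g)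
    (conf (Head2, e, o, q)
       (zipper (bit false :: catrev (nseq a (bit true)) l) (map bit y)) tX
       (zipper (bit false :: catrev (nseq a (bit true)) v) [::])
       (zipper (bit true :: catrev (nseq a (bit true)) w) [::]) tB g).
Proof.
elim: a l v w => [|a ih] l v w; apply: leadsS; rewrite step_conf //= !stepE.
  by [].
exact: ih.
Qed.

Lemma Head1_rejects a l v w e o q tX tB g :
  decides a.+1
    (conf (Head1, e, o, q) (zipper l (map bit (nseq a true)))
       tX (zipper v [::]) (zipper w [::]) tB g) false.
Proof.
elim: a l v w => [|a ih] l v w; rewrite decidesS step_conf //= !stepE /=.
exact: ih.
Qed.

(** The closing 1 moves the head of W back onto its last mark, where the countdown starts; this
    splits the tape around that mark and exposes the blank after it. *)
Lemma Head2_leads c y l v w e o q tX tB g :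
  leads c.+1
    (conf (Head2, e, o, q) (zipper l (map bit (nseq c false ++ true :: y)))
       tX (zipper v [::]) (zipper w [::]) tB g)
    (conf (Back ToNext, e, o, q)
       (zipper (bit true :: catrev (nseq c (bit false)) l) (map bit y)) tX
       (zipper (catrev (nseq c (bit false)) v) [::])
       (zipper (behead (catrev (nseq c (bit true)) w))
          [:: head None (catrev (nseq c (bit true)) w); None]) tB g).
Proof.
elim: c l v w => [|c ih] l v w; apply: leadsS; rewrite step_conf //= !stepE.
  by [].
exact: ih.
Qed.

Lemma Head2_rejects c l v w e o q tX tB g :
  decides c.+1
    (conf (Head2, e, o, q) (zipper l (map bit (nseq c false)))
       tX (zipper v [::]) (zipper w [::]) tB g) false.
Proof.
elim: c l v w => [|c ih] l v w; rewrite decidesS step_conf //= !stepE /=.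
exact: ih.
Qed.

(** * Rewinding and erasing tapes in parallel *)

Definition retreated t : vtape := act (retreat (t 0%R)) t.
Definition erased t : vtape := act (erase (t 0%R)) t.

Lemma iter_retreated n t : ~~ isSome (t 0%R) -> iter n retreated t = t.
Proof.
move=> h; elim: n => //= n ->; rewrite /retreated /retreat.
by case E: (t 0%R) h => // _; rewrite -E act_stay.
Qed.

Lemma iter_erased n t : ~~ isSome (t 0%R) -> iter n erased t = t.
Proof.
move=> h; elim: n => //= n ->; rewrite /erased /erase.
by case E: (t 0%R) h => // _; rewrite -E act_stay.
Qed.

(** The initial form is the one left by [Back], one cell to the left of the old head. The head then
    stops on the first blank, so any bound [n] on the length of [l] will do. *)
Lemma retreated_zipper n l r : all isSome l -> size l <= n ->
  iter n retreated (zipper (behead l) (head None l :: r)) =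
  zipper [::] (None :: rev l ++ r).
Proof.
elim: l n r => [|a l ih] n r; first by rewrite iter_retreated ?zipper0.
case: n a => // n [a|//] /andP[_ sl] le; rewrite iterSr /retreated zipper0 /=.
rewrite /retreat; rewrite act_left ih //.
by rewrite rev_cons cat_rcons.
Qed.

Lemma erased_zipper n r : all isSome r -> size r <= n ->
  iter n erased (zipper [::] r) = blank.
Proof.
elim: r n => [|a r ih] n; first by rewrite iter_erased ?zipper0.
case: n a => // n [a|//] /andP[_ sr] le; rewrite iterSr /erased zipper0 /=.
by rewrite /erase act_right zipper_left_blank ih.
Qed.

Lemma Rewind_exit n p e o q t0 tX tV tW tB g :
    [&& ~~ isSome (tX 0%R), ~~ isSome (tV 0%R), ~~ isSome (tB 0%R) &
        [forall j, ~~ isSome (g j 0%R)]] ->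
  leads n.+1 (conf (Rewind p, e, o, q) t0 tX tV tW tB g)
    (conf (resume p e o q) t0 (act (None, MoveRight) (iter n retreated tX))
       (act (None, MoveRight) (iter n retreated tV)) tW
       (act (None, MoveRight) (iter n retreated tB))
       (fun j => act (None, MoveRight) (iter n retreated (g j)))).
Proof.
move=> h; apply: (@leads_le _ _ 1) => //; apply: leads1.
rewrite step_conf //= h /= !stepE; case/and4P: h => hX hV hB /forallP hg.
rewrite !iter_retreated //.
move: hX hV hB; case: (tX 0%R) => // _; case: (tV 0%R) => // _.
case: (tB 0%R) => // _; congr conf.
apply: functional_extensionality => j; rewrite iter_retreated //.
by case: (g j 0%R) (hg j).
Qed.

(** A tape that has reached its blank stays there, so the same number [n] of iterations describes
    every tape, even if all of them arrive earlier. *)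
Lemma Rewind_leads n p e o q t0 tX tV tW tB g :
    ~~ isSome (iter n retreated tX 0%R) ->
    ~~ isSome (iter n retreated tV 0%R) ->
    ~~ isSome (iter n retreated tB 0%R) ->
    (forall j, ~~ isSome (iter n retreated (g j) 0%R)) ->
  leads n.+1 (conf (Rewind p, e, o, q) t0 tX tV tW tB g)
    (conf (resume p e o q) t0 (act (None, MoveRight) (iter n retreated tX))
       (act (None, MoveRight) (iter n retreated tV)) tW
       (act (None, MoveRight) (iter n retreated tB))
       (fun j => act (None, MoveRight) (iter n retreated (g j)))).
Proof.
elim: n tX tV tB g => [|n ih] tX tV tB g hX hV hB hg.
  by apply: Rewind_exit; apply/and4P; split => //; apply/forallP.
case h: [&& ~~ isSome (tX 0%R), ~~ isSome (tV 0%R), ~~ isSome (tB 0%R) &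
    [forall j, ~~ isSome (g j 0%R)]]; first exact: Rewind_exit.
apply: leadsS; rewrite step_conf //= h /= !stepE.
have -> : 
    (fun j => act (None, MoveRight) (retreated (iter n retreated (g j)))) =
    (fun j => act (None, MoveRight) (iter n retreated (retreated (g j)))).
  by apply: functional_extensionality => j; rewrite -iterS iterSr.
rewrite -!iterS !iterSr; apply: ih; rewrite -?iterSr // => j.
by rewrite -iterSr.
Qed.

(** The preliminary move left takes a head off the blank just after its word, where [Rewind] would
    stop at once; the final move right leads from the blank on the left to the first cell. *)
Lemma Back_leads n p e o q t0 lX rX lV rV tW lB rB (l r : mtape -> seq symbol) :
    all isSome lX -> all isSome lV -> all isSome lB ->
    (forall j, all isSome (l j)) ->
    size lX <= n -> size lV <= n -> size lB <= n ->
    (forall j, size (l j) <= n) ->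
  leads n.+2
    (conf (Back p, e, o, q) t0 (zipper lX rX) (zipper lV rV) tW (zipper lB rB)
       (fun j => zipper (l j) (r j)))
    (conf (resume p e o q) t0 (zipper [::] (rev lX ++ rX))
       (zipper [::] (rev lV ++ rV)) tW (zipper [::] (rev lB ++ rB))
       (fun j => zipper [::] (rev (l j) ++ r j))).
Proof.
move=> sX sV sB sl nX nV nB nl; apply: leadsS; rewrite step_conf //= !stepE.
have -> :
    (fun j => act (zipper (l j) (r j) 0%R, MoveLeft) (zipper (l j) (r j))) =
    (fun j => zipper (behead (l j))
                (head None (l j) :: head None (r j) :: behead (r j))).
  by apply: functional_extensionality => j; rewrite !stepE.
have rew l' r' : all isSome l' -> size l' <= n ->
  act (None, MoveRight) (iter n retreated
    (zipper (behead l') (head None l' :: head None r' :: behead r'))) =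
  zipper [::] (rev l' ++ r').
  move=> s' n'; rewrite retreated_zipper // act_right /= zipper_left_blank.
  by rewrite zipper_head_behead.
rewrite -(rew lX) // -(rew lV) // -(rew lB) //.
have -> : (fun j => zipper [::] (rev (l j) ++ r j)) =
  (fun j => act (None, MoveRight) (iter n retreated (zipper (behead (l j))
              (head None (l j) :: head None (r j) :: behead (r j))))).
  by apply: functional_extensionality => j; rewrite rew.
by apply: Rewind_leads => [||| j]; rewrite retreated_zipper ?zipper0.
Qed.

Lemma Erase_leads n e o q t0 tX tV tW tB (r : mtape -> seq symbol) :
    (forall j, all isSome (r j)) -> (forall j, size (r j) <= n) ->
  leads n.+1
    (conf (Erase, e, o, q) t0 tX tV tW tB (fun j => zipper [::] (r j)))
    (conf (Next, e, o, q) t0 tX tV (act (tW 0%R, MoveLeft) tW) tB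
       (input_only blank)).
Proof.
(* Being blank after [n] erasures, unlike a fixed zipper form, is an assumption that passes to
   [n - 1] after one step. *)
have main : forall g, (forall j, iter n erased (g j) = blank) ->
  leads n.+1 (conf (Erase, e, o, q) t0 tX tV tW tB g)
    (conf (Next, e, o, q) t0 tX tV (act (tW 0%R, MoveLeft) tW) tB
       (input_only blank)).
  have exit m g : (forall j, iter m erased (g j) = blank) ->
      [forall j, ~~ isSome (g j 0%R)] ->
      leads m.+1 (conf (Erase, e, o, q) t0 tX tV tW tB g)
        (conf (Next, e, o, q) t0 tX tV (act (tW 0%R, MoveLeft) tW) tB
           (input_only blank)).
    move=> h hg; apply: (@leads_le _ _ 1) => //; apply: leads1.
    rewrite step_conf //= hg /= !stepE; congr conf.
    rewrite input_only_blank; apply: functional_extensionality => j.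
    by rewrite -(h j) iter_erased //; exact: (forallP hg j).
  elim: n => [|n ih] g h.
    by apply: exit => //; apply/forallP => j; rewrite (h j : g j = _) zipper0.
  case hg: [forall j, ~~ isSome (g j 0%R)]; first exact: exit.
  apply: leadsS; rewrite step_conf //= hg /= !stepE.
  by apply: ih => j; rewrite -iterSr.
by move=> sr nr; apply: main => j; rewrite erased_zipper.
Qed.

(** * Reading one block and the tail *)

Lemma CopyIn_leads s l i e o q t0 tV tW tB : all isSome s ->
  leads (size s).+1
    (conf (CopyIn, e, o, q) t0 (zipper l s) tV tW tB
       (input_only (zipper i [::])))
    (conf (Data, e, None, q) t0 (zipper (catrev s l) [::]) tV tW tB
       (input_only (zipper (catrev s i) [::]))).
Proof.
elim: s l i => [|u s ih] l i /=.
  by move=> _; apply: leads1; rewrite step_conf //= !stepE /= ?stepE.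
move=> /andP[]; case: u => // u _ ss; apply: leadsS.
by rewrite step_conf //= !stepE /= ?stepE; apply: ih.
Qed.

Fixpoint compare_word (o : option bool) (prev d : seq bool) : option bool :=
  if d is b :: d' then
    compare_word (compare_bit o (ohead prev) b) (behead prev) d'
  else o.

(** The bound on [prev] admits the empty word before the first block and ensures that the old
    content of B is entirely overwritten. *)
Lemma Data_leads d z r prev l v b i e o q tX tW : size prev <= size d ->
  leads (size d).+1
    (conf (Data, e, o, q) (zipper l (map bit (d ++ z))) tX
       (zipper v (nseq (size d) (bit true) ++ bit false :: r)) tW
       (zipper b (map bit prev)) (input_only (zipper i [::])))
    (conf (Pad, e, compare_word o prev d, q)
       (zipper (catrev (map bit d) l) (map bit z)) tX
       (zipper (catrev (nseq (size d) (bit true)) v) (bit false :: r)) tW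
       (zipper (catrev (map bit d) b) [::])
       (input_only (zipper (catrev (map bit d) i) [::]))).
Proof.
elim: d prev l v b i o => [|x d ih] prev l v b i o /=.
  case: prev => // _; apply: leads1; rewrite step_conf //= !stepE /= ?stepE.
  by [].
move=> le; apply: leadsS; rewrite step_conf //= !stepE /= ?stepE /=.
have -> : behead (map bit prev) = map bit (behead prev) by case: prev {le}.
have -> : bit_of (head None (map bit prev)) = ohead prev by case: prev {le}.
apply: ih; case: prev le => //.
Qed.

Lemma Data_rejects d n r prev l v b i e o q tX tW : size d < n ->
  decides (size d).+1
    (conf (Data, e, o, q) (zipper l (map bit d)) tX
       (zipper v (nseq n (bit true) ++ r)) tW
       (zipper b (map bit prev)) (input_only (zipper i [::]))) false.
Proof.
elim: d n prev l v b i o => [|x d ih] [|n] // prev l v b i o /= lt;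
  rewrite decidesS step_conf //= !stepE /= ?stepE /=.
have -> : behead (map bit prev) = map bit (behead prev) by case: prev.
exact: ih.
Qed.

Lemma Pad_leads c z l v e o q tX tW tB g :
    (if o is Some b then b && ~~ e else true) ->
  leads c.+1
    (conf (Pad, e, o, q) (zipper l (map bit (nseq c false ++ z))) tX
       (zipper v (nseq c (bit false))) tW tB g)
    (conf (Back ToRun, ~~ isSome o, o, q)
       (zipper (catrev (nseq c (bit false)) l) (map bit z)) tX
       (zipper (catrev (nseq c (bit false)) v) [::]) tW tB g).
Proof.
move=> ho; elim: c l v => [|c ih] l v.
  apply: leads1; rewrite step_conf //= !stepE /=.
  by case: o ho => [b /= ->|_] /=; rewrite !stepE.
by apply: leadsS; rewrite step_conf //= !stepE /= ?stepE; apply: ih.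
Qed.

Lemma Pad_rejects_padding c z l v e o q tX tW tB g :
    take c z != nseq c false ->
  decides c.+1
    (conf (Pad, e, o, q) (zipper l (map bit z)) tX
       (zipper v (nseq c (bit false))) tW tB g) false.
Proof.
elim: c z l v => [|c ih] [|b z] l v //=.
  move=> _; rewrite decidesS step_conf //= !stepE /= ?stepE.
  exact: decides_Done.
rewrite eqseq_cons negb_and => ne.
rewrite decidesS step_conf //= !stepE /= ?stepE /=.
case: b ne => /= ne; rewrite ?stepE; first exact: decides_Done.
exact: ih.
Qed.

Lemma Pad_rejects_order c z l v e o q tX tW tB g :
    ~~ (if o is Some b then b && ~~ e else true) ->
  decides c.+1
    (conf (Pad, e, o, q) (zipper l (map bit (nseq c false ++ z))) tX
       (zipper v (nseq c (bit false))) tW tB g) false.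
Proof.
move=> ho; elim: c l v => [|c ih] l v.
  rewrite decidesS step_conf //= !stepE /=.
  case: o ho => [b|] //= /negPf ->; rewrite ?stepE; exact: decides_Done.
by rewrite decidesS step_conf //= !stepE /= ?stepE; apply: ih.
Qed.

Lemma Tail_decides a z r l v e o q tX tW tB g :
  decides a.+1
    (conf (Tail, e, o, q) (zipper l (map bit z)) tX
       (zipper v (nseq a (bit true) ++ bit false :: r)) tW tB g)
    (z == nseq a false).
Proof.
elim: a z l v => [|a ih] [|b z] l v;
  rewrite decidesS step_conf //= !stepE /= ?stepE; try exact: decides_Done.
rewrite eqseq_cons; case: b => /=; rewrite ?stepE; first exact: decides_Done.
exact: ih.
Qed.

(* When [l] is empty the head may stand on the unvisited cell just left of the
   visited region, whence the special role of the first cell of [r]. *)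
Definition contiguous l r : bool :=
  [&& all isSome l, all isSome (behead r) & nilp l || all isSome r].

Definition zipper_move (m : move) (u : symbol) l r : seq symbol * seq symbol :=
  match m with
  | MoveLeft => (behead l, head None l :: u :: behead r)
  | Stay => (l, u :: behead r)
  | MoveRight => (u :: l, behead r)
  end.

Lemma act_zipper_move u m l r : act (u, m) (zipper l r) =
  zipper (zipper_move m u l r).1 (zipper_move m u l r).2.
Proof. by case: m; rewrite ?act_left ?act_write ?act_right. Qed.

(** The cell left behind is marked, and the cell entered is unmarked only on leaving the region: to
    the right [r] becomes empty, to the left [l] was empty. *)
Lemma contiguous_move m a l r : contiguous l r ->
  contiguous (zipper_move m (visited a) l r).1
             (zipper_move m (visited a) l r).2.
Proof.
move=> /and3P[sl sr _]; rewrite /contiguous; case: m => /=.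
- by case: l sl => [|u l] /= => [_|/andP[-> ->]]; rewrite sr ?orbT.
- by rewrite sl sr orbT.
by rewrite sl sr !andbT; case: (behead r) sr => //= u r' /andP[].
Qed.

Lemma size_zipper_move m u l r :
  size (zipper_move m u l r).1 + size (zipper_move m u l r).2 <=
  (size l + size r).+2.
Proof. by case: m => /=; rewrite !size_behead; lia. Qed.

Lemma decode_act a m t (t' : tape (option bool) (work M)) :
    (forall i, decode (t i) = t' i) ->
  forall i, decode (act (visited a, m) t i) = tape_move m (tape_write a t') i.
Proof. by move=> h; case: m => i; rewrite /act /tape_write /=; case: eqP. Qed.

(** * Simulation of the given machine *)

Section Simulation.
Variables (e : bool) (o : option bool) (t0 tX tV tW tB : vtape).

Lemma Run_rejects n (c : config M) (l r : mtape -> seq symbol) :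
    (forall j i, decode (zipper (l j) (r j) i) = c.2 j i) ->
    decides n c false ->
  decides n.+1
    (conf (Run, e, o, c.1) t0 tX tV tW tB (fun j => zipper (l j) (r j))) false.
Proof.
elim: n c l r => [|n ih] c l r hc hv; rewrite decidesS step_conf //=.
  by rewrite hv; exact: decides_Done.
case v: (verdict c.1) => [b|].
  by rewrite (decides_halted v hv); exact: decides_Done.
move: hv; rewrite decidesS /step v.
have -> : [ffun j => decode (zipper (l j) (r j) 0%R)] = [ffun j => c.2 j 0%R].
  by apply/ffunP => j; rewrite !ffunE hc.
case: (delta _ _) => q' a /= hv; rewrite !stepE.
under [fun j => _]functional_extensionality => j do rewrite act_zipper_move.
apply: (ih (q', _)
  (fun j => (zipper_move (a j).2 (visited (a j).1) (l j) (r j)).1)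
  (fun j => (zipper_move (a j).2 (visited (a j).1) (l j) (r j)).2)) hv.
by move=> j i /=; rewrite -act_zipper_move ffunE; apply: decode_act.
Qed.

(** Besides agreement with [M] after decoding, the induction carries contiguity and size, which the
    later rewinding and erasing rely on. A simulated step adds at most two cells to a zipper, and
    the final mark one more. *)
Lemma Run_accepts n k (c : config M) (l r : mtape -> seq symbol) :
    (forall j i, decode (zipper (l j) (r j) i) = c.2 j i) ->
    (forall j, contiguous (l j) (r j)) ->
    (forall j, size (l j) + size (r j) <= k) ->
    decides n c true ->
  exists (q : state M) (l' r' : mtape -> seq symbol),
    [/\ forall j, all isSome (l' j), forall j, all isSome (r' j),
        forall j, size (l' j) + size (r' j) <= k + n.*2.+1 &
        leads n.+1
          (conf (Run, e, o, c.1) t0 tX tV tW tB (fun j => zipper (l j) (r j)))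
          (conf (Back ToErase, e, o, q) t0 tX tV tW tB
             (fun j => zipper (l' j) (r' j)))].
Proof.
move=> hc cont; elim: n k c l r hc cont => [|n ih] k c l r hc cont hk hv;
  case v: (verdict c.1) => [b|].
3: have eb : b = true.
3: exact: decides_halted v hv.
(* Here [M] has halted: marking the scanned cells fills the only gap that [contiguous] permits. *)
1,3: exists c.1, l, (fun j => visited None :: behead (r j)); split => [j|j|j|];
   [by case/and3P: (cont j)|by case/and3P: (cont j)
   |by have := hk j; rewrite /= size_behead; lia
   |apply: (@leads_le _ _ 1) => //; apply: leads1; rewrite step_conf //= v ?eb].
- by move: hv; rewrite /decides /= v => -[->]; rewrite !stepE; congr conf;
     apply: functional_extensionality => j; rewrite act_write.
- by rewrite !stepE; congr conf; apply: functional_extensionality => j;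
     rewrite act_write.
- by move: hv; rewrite /decides /= v.
set a := (delta c.1 [ffun j => c.2 j 0%R]).2.
set q' := (delta c.1 [ffun j => c.2 j 0%R]).1.
have [||j||q [l' [r' [sl sr sk ld]]]] := ih k.+2 (step c)
  (fun j => (zipper_move (a j).2 (visited (a j).1) (l j) (r j)).1)
  (fun j => (zipper_move (a j).2 (visited (a j).1) (l j) (r j)).2).
- move=> j i; rewrite -act_zipper_move (@decode_act _ _ _ (c.2 j)) //.
  by rewrite /step v /a; case: (delta _ _) => q1 a' /=; rewrite ffunE.
- by move=> j; exact: contiguous_move.
- by apply: leq_trans (size_zipper_move _ _ _ _) _; rewrite !ltnS.
- by rewrite -decidesS.
exists q, l', r'; split => // [j|]; first by have := sk j; lia.
apply: leadsS; rewrite step_conf //= v.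
have -> : [ffun j => decode (zipper (l j) (r j) 0%R)] = [ffun j => c.2 j 0%R].
  by apply/ffunP => j; rewrite !ffunE hc.
have es : (step c).1 = q' by rewrite /step v /q'; case: (delta _ _).
move: ld; rewrite es /a /q'; case: (delta _ _) => q'' a'' /= ld; rewrite !stepE.
by under [fun j => act _ _]functional_extensionality => j
  do rewrite act_zipper_move.
Qed.

End Simulation.

End VerifierPhases.

(** * The accepted strings *)

Section Blocks.
Variable R : bitstring -> bitstring -> bool.

Definition in_order (e : bool) (o : option bool) : bool :=
  if o is Some b then b && ~~ e else true.

Fixpoint check_blocks (x : bitstring) (a c n : nat) (prev : bitstring)
    (e : bool) (z : bitstring) : bool :=
  if n is n'.+1 then
    let d := take a z in
    let o := compare_word None prev d in
    [&& a <= size z, take c (drop a z) == nseq c false, in_order e o, R x d &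
        check_blocks x a c n' d (~~ isSome o) (drop c (drop a z))]
  else z == nseq a false.

(** When nonempty, [y'] begins with [false], so a complete header has [c > 0]. *)
Definition check (x y : bitstring) : bool :=
  let a := index false y in
  let y' := drop a y in
  let c := index true y' in
  (c < size y') && check_blocks x a c (a + c) [::] false (drop c.+1 y').

Lemma check_ones x a : check x (nseq a true) = false.
Proof.
have n0 : false \notin nseq a true by rewrite mem_nseq andbF.
by rewrite /check (memNindex n0) drop_size.
Qed.

Lemma index_prefix (b : bool) n s : index b (nseq n (~~ b) ++ b :: s) = n.
Proof.
elim: n => [|n /= ->] /=; first by rewrite eqxx.
by case: b.
Qed.

Lemma check_zeros x a c :
  check x (nseq a true ++ false :: nseq c false) = false.
Proof.
rewrite /check (index_prefix false) drop_size_cat ?size_nseq //.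
by rewrite -[false :: _]/(nseq c.+1 false) index_mem mem_nseq andbF.
Qed.

Lemma check_header x a c z :
  check x (nseq a true ++ nseq c.+1 false ++ true :: z) =
  check_blocks x a c.+1 (a + c.+1) [::] false z.
Proof.
rewrite /check (index_prefix false a (nseq c false ++ true :: z)).
rewrite drop_size_cat ?size_nseq // (index_prefix true c.+1).
rewrite -cat1s catA drop_size_cat; last by rewrite size_cat size_nseq addn1.
by rewrite (_ : (_ < _) = true) // !size_cat size_nseq /=; lia.
Qed.

(** The three outcomes of reading the header: the input ends during [Head1], it ends during [Head2],
    or the header is complete. *)
Lemma headerP (y : bitstring) :
  [\/ exists a, y = nseq a true,
      exists a c, y = nseq a true ++ false :: nseq c false |
      exists a c z, y = nseq a true ++ nseq c.+1 false ++ true :: z].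
Proof.
elim: y => [|[] y ih]; first by apply: Or31; exists 0.
  case: ih => [[a ->]|[a [c ->]]|[a [c [z ->]]]].
  - by apply: Or31; exists a.+1.
  - by apply: Or32; exists a.+1, c.
  - by apply: Or33; exists a.+1, c, z.
(* A [false] in front of a nonempty run of ones completes a header without leading ones and with a
   single zero; the first of those ones is its delimiter. *)
case: ih => [[[|a] ->]|[[|a] [c ->]]|[[|a] [c [z ->]]]].
- by apply: Or32; exists 0, 0.
- by apply: Or33; exists 0, 0, (nseq a true).
- by apply: Or32; exists 0, c.+1.
- by apply: Or33; exists 0, 0, (nseq a true ++ false :: nseq c false).
- by apply: Or33; exists 0, c.+1, z.
by apply: Or33; exists 0, 0, (nseq a true ++ nseq c.+1 false ++ true :: z).
Qed.

End Blocks.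

(** * Correctness of the verifier *)

Section VerifierCorrect.
Variable M : machine (option bool).

Notation mtape := 'I_(ntapes M).+1.
Notation vwork := (cell (option bool) (work M)).
Notation symbol := (cell (option bool) vwork).
Notation vtape := (tape (option bool) vwork).
Notation blank := (zipper [::] [::] : vtape).
Notation bit := (bit M).
Notation conf := (@conf M).

Definition word (w : seq (option bool)) : seq symbol :=
  [seq Some (inl a) | a <- w].

(** Tape W with [n] blocks to go: the head is on the [n]-th mark, or for [n = 0] on the blank before
    the first; [r] is what has been passed. *)
Definition countdown n (r : seq symbol) : vtape :=
  zipper (nseq n.-1 (bit true)) ((if n is 0 then None else bit true) :: r).

Arguments countdown : simpl never.

Lemma countdown0 n r : countdown n r 0%R = if n is 0 then None else bit true.
Proof. by rewrite /countdown zipper0. Qed.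

Lemma countdownS n r :
  act (countdown n.+1 r 0%R, MoveLeft) (countdown n.+1 r) =
  countdown n (bit true :: r).
Proof. by rewrite countdown0 act_left; case: n. Qed.

Definition ruler a c : seq symbol := nseq a (bit true) ++ nseq c (bit false).

Definition xcode (x : bitstring) : seq symbol := word (rcons (map Some x) None).

Lemma word_isSome w : all isSome (word w).
Proof. by elim: w. Qed.

Lemma mapbitE d : map bit d = word (map Some d).
Proof. by rewrite /word -map_comp. Qed.

Lemma xcode_cat x d : xcode x ++ map bit d = word (pair_code x d).
Proof. by rewrite mapbitE /xcode /word -map_cat cat_rcons. Qed.

Lemma size_xcode x : size (xcode x) = (size x).+1.
Proof. by rewrite size_map size_rcons size_map. Qed.

Lemma ruler_isSome a c : all isSome (ruler a c).
Proof. by rewrite all_cat !all_nseq !orbT. Qed.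

Lemma size_ruler a c : size (ruler a c) = a + c.
Proof. by rewrite size_cat !size_nseq. Qed.

Lemma input_only_zipper (l r : seq symbol) :
  input_only (zipper l r) =
  (fun j : mtape => zipper (if j == ord0 then l else [::])
                           (if j == ord0 then r else [::])).
Proof.
by apply: functional_extensionality => j; rewrite /input_only; case: eqP.
Qed.

Lemma decode_init w (j : mtape) i :
  decode (input_only (zipper [::] (word w)) j i) = (init M w).2 j i.
Proof.
rewrite /init ffunE /input_only; case: eqP => _; last first.
  by rewrite zipper_blank.
rewrite input_tapeE; case: i => n; rewrite /zipper ?nth_nil //.
case: (ltnP n (size w)) => h; last by rewrite !nth_default ?size_map.
by rewrite !(nth_map None).
Qed.

Lemma Next_leads n e o q t0 tX tV tB g r :
  leads 1 (conf (Next, e, o, q) t0 tX tV (countdown n r) tB g)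
    (conf (if n is 0 then Tail else CopyIn, e, o, q)
       t0 tX tV (countdown n r) tB g).
Proof.
by apply: leads1; rewrite step_conf //= !act_stay act_idle countdown0; case: n.
Qed.

Section FixedInput.
Variables (R : bitstring -> bitstring -> bool) (x : bitstring) (a c N T : nat).
Hypothesis MR : forall d, size d = a -> halts_with M (pair_code x d) T (R x d).
Hypothesis leN : (size x).+1 + a + c.+1 <= N.

(** The phases of one round add up to at most [4 * N + 5 * T + 14] steps, and [N] is at least 2. *)
Definition block_time := 12 * (N + T + 1).

Let tX := zipper [::] (xcode x).
Let tV := zipper [::] (ruler a c.+1).

(** [CopyIn] and [Data] have written [x#] and [d] one after the other, so [M] is left facing its
    input [pair_code x d]. *)
Lemma rewind_block e o q t0 d tW : size d = a ->
  leads N.+2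
    (conf (Back ToRun, e, o, q) t0 (zipper (catrev (xcode x) [::]) [::])
       (zipper (catrev (nseq c.+1 (bit false))
                  (catrev (nseq a (bit true)) [::])) [::]) tW
       (zipper (catrev (map bit d) [::]) [::])
       (input_only (zipper (catrev (map bit d) (catrev (xcode x) [::])) [::])))
    (conf (Run, e, o, start M) t0 tX tV tW (zipper [::] (map bit d))
       (input_only (zipper [::] (word (pair_code x d))))).
Proof.
move=> sd; rewrite !catrevE !cats0 -!rev_cat -/(ruler a c.+1) xcode_cat.
rewrite !input_only_zipper.
have := @Back_leads M N ToRun e o q t0 (rev (xcode x)) [::]
  (rev (ruler a c.+1)) [::] tW (rev (map bit d)) [::]
  (fun j => if j == ord0 then rev (word (pair_code x d)) else [::])
  (fun j => if j == ord0 then [::] else [::]).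
rewrite !all_rev !size_rev !revK !cats0 size_xcode size_ruler size_map.
rewrite !word_isSome ruler_isSome mapbitE word_isSome => H.
have -> : (fun j : mtape => zipper (if j == ord0 then [::] else [::])
             (if j == ord0 then word (pair_code x d) else [::])) =
  (fun j => zipper [::]
    (rev (if j == ord0 then rev (word (pair_code x d)) else [::]) ++
     (if j == ord0 then [::] else [::]))).
  by apply: functional_extensionality => j; case: eqP; rewrite ?revK ?cats0.
apply: H => //; try lia.
  by move=> j; case: eqP; rewrite // all_rev word_isSome.
move=> j; case: eqP => // _.
by rewrite size_rev size_map size_cat /= !size_map; lia.
Qed.

Let size_pair_code d : size d = a -> size (pair_code x d) <= N.
Proof. by rewrite size_cat /= !size_map; lia. Qed.

Lemma run_block_rejects e o t0 d tW tB : size d = a -> R x d = false ->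
  decides T.+1
    (conf (Run, e, o, start M) t0 tX tV tW tB
       (input_only (zipper [::] (word (pair_code x d))))) false.
Proof.
move=> sd Rd; rewrite input_only_zipper.
apply: (@Run_rejects M e o t0 tX tV tW tB T (init M (pair_code x d))).
  by move=> j i; rewrite -decode_init input_only_zipper.
by have := MR sd; rewrite Rd.
Qed.

Lemma run_block_leads e o t0 d tW : size d = a -> R x d ->
  exists q, leads (N + N + T * 5 + 8)
    (conf (Run, e, o, start M) t0 tX tV tW (zipper [::] (map bit d))
       (input_only (zipper [::] (word (pair_code x d)))))
    (conf (Next, e, o, q) t0 tX tV (act (tW 0%R, MoveLeft) tW)
       (zipper [::] (map bit d)) (input_only blank)).
Proof.
move=> sd Rd.
have [|j|j||q [l [r [sl sr slr run]]]] := @Run_accepts M e o t0 tX tV tW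
  (zipper [::] (map bit d)) T N (init M (pair_code x d))
  (fun j => if j == ord0 then [::] else [::])
  (fun j => if j == ord0 then word (pair_code x d) else [::]).
- by move=> j i; rewrite -decode_init input_only_zipper.
- case: eqP => // _; have := word_isSome (pair_code x d); rewrite /contiguous.
  by case: (word _) => //= ? ? /andP[_ ->].
- by case: eqP => // _; rewrite size_map /= size_pair_code.
- by have := MR sd; rewrite Rd.
(* [K] bounds the marked region: the input, two cells per simulated step and the acceptance mark. *)
exists q; pose K := N + T.*2.+1.
have lK j : size (l j) <= K := leq_trans (leq_addr _ _) (slr j).
have := @Back_leads M K ToErase e o q t0 [::] (xcode x) [::] (ruler a c.+1) tW
  [::] (map bit d) l r isT isT isT sl isT isT isT lK.
have := @Erase_leads M K e o q t0 tX tV tW (zipper [::] (map bit d))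
  (fun j => rev (l j) ++ r j).
rewrite /= => er bk.
rewrite input_only_zipper.
apply: (leads_le _ (leads_trans run (leads_trans bk (er _ _)))) => [|j|j].
- by rewrite /K; lia.
- by rewrite all_cat all_rev sl sr.
by rewrite size_cat size_rev; exact: slr.
Qed.

(** Induction on the number of blocks left. The conjuncts of [check_blocks] come in the order in
    which the phases test them, so the first one to fail is matched by a rejecting phase. *)
Lemma Next_decides n prev e o q z l r : size prev <= a ->
  decides (n * block_time + a.+2)
    (conf (Next, e, o, q) (zipper l (map bit z)) tX tV (countdown n r)
       (zipper [::] (map bit prev)) (input_only blank))
    (check_blocks R x a c.+1 n prev e z).
Proof.
elim: n prev e o q z l r => [|n ih] prev e o q z l r le.
  apply: decides_via (@Next_leads _ _ _ _ _ _ _ _ _ _) _ _ => //.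
  exact: (@Tail_decides M a z (nseq c (bit false))).
apply: decides_via (@Next_leads _ _ _ _ _ _ _ _ _ _) _ _.
  by rewrite mulSn /block_time; lia.
apply: decides_via
  (@CopyIn_leads M (xcode x) _ _ _ _ _ _ _ _ _ (word_isSome _)) _ _.
  by rewrite size_xcode mulSn /block_time; lia.
rewrite size_xcode.
case: (leqP a (size z)) => [lez|ltz]; last first.
  rewrite /= [a <= size z]leqNgt ltz.
  apply: decides_le (@Data_rejects M z a _ prev _ _ _ _ _ _ _ _ _ ltz).
  by rewrite mulSn /block_time; lia.
set d := take a z; set z' := drop a z.
have sd : size d = a by rewrite size_take_min; lia.
have -> : z = d ++ z' by rewrite cat_take_drop.
apply: (@decides_via _ _ a.+1).
- have := @Data_leads M d z' (nseq c (bit false)) prev l [::] [::]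
     (catrev (xcode x) [::]) e None q (zipper (catrev (xcode x) [::]) [::])
     (countdown n.+1 r).
  by rewrite sd; apply.
- by rewrite mulSn /block_time; lia.
rewrite [check_blocks _ _ _ _ _ _ _ _]/= -/d drop_size_cat // take_size_cat //.
rewrite size_cat sd leq_addr /=.
set o' := compare_word None prev d.
case: eqP => [ez|/eqP ez] /=; last first.
  apply: decides_le (@Pad_rejects_padding M c.+1 z' _ _ _ _ _ _ _ _ _ ez).
  by rewrite mulSn /block_time; lia.
rewrite -[z'](cat_take_drop c.+1) ez.
case: (boolP (in_order e o')) => [ho|ho] /=; last first.
  apply: decides_le (@Pad_rejects_order M c.+1 _ _ _ _ _ _ _ _ _ _ ho).
  by rewrite mulSn /block_time; lia.
apply: decides_via (@Pad_leads M c.+1 _ _ _ _ _ _ _ _ _ _ ho) _ _.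
  by rewrite mulSn /block_time; lia.
rewrite drop_size_cat ?size_nseq //; move: (drop c.+1 z') => z1.
apply: decides_via (@rewind_block _ _ _ _ _ _ sd) _ _ => //.
  by rewrite mulSn /block_time; lia.
case Rd: (R x d); last first.
  apply: decides_le (run_block_rejects _ _ _ _ _ sd Rd).
  by rewrite mulSn /block_time; lia.
have [q' H] := run_block_leads (~~ isSome o') o'
  (zipper (catrev (nseq c.+1 (bit false)) (catrev (map bit d) l)) (map bit z1))
  (countdown n.+1 r) sd Rd.
apply: decides_via H _ _; first by rewrite mulSn /block_time; lia.
rewrite countdownS; apply: decides_le (ih _ _ _ _ _ _ _ _); last by rewrite sd.
by rewrite mulSn /block_time; lia.
Qed.

End FixedInput.
End VerifierCorrect.

(** * Polynomial running time of the verifier *)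

Lemma horner_nat_le (p : {poly nat}) (m n : nat) :
  m <= n -> (p.[m]%R : nat) <= (p.[n]%R : nat).
Proof.
move=> le; elim/poly_ind: p => [|p c ih]; first by rewrite !horner0.
by rewrite !hornerMXaddC; apply: leq_add => //; apply: leq_mul.
Qed.

Section VerifierPolytime.
Variables (M : machine (option bool)) (t : {poly nat}).
Variable R : bitstring -> bitstring -> bool.
Hypothesis MR : forall x y : bitstring,
  halts_with M (pair_code x y) t.[size (pair_code x y)]%R (R x y).

Notation bit := (bit M).

Lemma verifier_decides x y (N := size (pair_code x y)) :
  decides (N.+1 * (12 * (N + t.[N]%R + 1))) (init (verifier M) (pair_code x y))
    (check R x y).
Proof.
have eN : N = (size x).+1 + size y.
  by rewrite /N size_cat /= !size_map addnS.
set T := t.[N]%R; rewrite init_conf; clearbody N.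
apply: decides_via (@CopyX_leads M x y _ _ _ _ _ _ _ _ _) _ _.
  by rewrite mulSn; lia.
case: (headerP y) => [[a ey]|[a [c ey]]|[a [c [z ey]]]].
- rewrite ey check_ones.
  apply: decides_le (@Head1_rejects M a _ _ _ _ _ _ _ _ _).
  by move: eN; rewrite ey size_nseq mulSn; lia.
- rewrite ey check_zeros.
  move: eN; rewrite ey size_cat /= !size_nseq => eN.
  apply: decides_via (@Head1_leads M a _ _ _ _ _ _ _ _ _ _) _ _.
    by rewrite mulSn; lia.
  apply: decides_le (@Head2_rejects M c _ _ _ _ _ _ _ _ _).
  by rewrite mulSn; lia.
rewrite ey check_header.
move: eN; rewrite ey !size_cat /= !size_nseq => eN.
apply: decides_via (@Head1_leads M a _ _ _ _ _ _ _ _ _ _) _ _.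
  by rewrite mulSn; lia.
apply: decides_via (@Head2_leads M c _ _ _ _ _ _ _ _ _ _) _ _.
  by rewrite mulSn; lia.
have eX : Some (inl None) :: catrev (map bit x) [::] = rev (xcode M x).
  by rewrite /xcode /word map_rcons rev_rcons -map_comp.
have eV : catrev (nseq c (bit false))
    (bit false :: catrev (nseq a (bit true)) [::]) = rev (ruler M a c.+1).
  rewrite /ruler !catrevE cats0 rev_cat.
  by rewrite -[nseq c.+1 _]/(bit false :: nseq c _) rev_cons cat_rcons.
have rev_nseq n (u : cell (option bool) (cell (option bool) (work M))) :
    rev (nseq n u) = nseq n u.
  elim: n => //= n ih.
  by rewrite rev_cons ih -cats1 -[[:: u]]/(nseq 1 u) -nseqD addn1.
have eW : catrev (nseq c (bit true))
    (bit true :: catrev (nseq a (bit true)) [::]) = nseq (a + c).+1 (bit true).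
  rewrite !catrevE cats0 !rev_nseq.
  by rewrite -[bit true :: _]/(nseq a.+1 _) -nseqD addnC.
rewrite eX eV eW /=.
apply: decides_via (@Back_leads M N _ _ _ _ _ _ _ _ _ _ [::] [::]
  (fun=> [::]) (fun=> [::]) _ _ _ _ _ _ _ _) _ _ => //.
- by rewrite all_rev word_isSome.
- by rewrite all_rev ruler_isSome.
- by rewrite size_rev size_xcode; lia.
- by rewrite size_rev size_ruler; lia.
- by rewrite mulSn; lia.
rewrite !revK !cats0 /= -(input_only_blank M).
rewrite -[zipper (nseq _ _) _]/(@countdown M (a + c).+1 [:: None]) -addnS.
(* The string [x#d] is no longer than the whole input, so by monotonicity of [t] one bound serves
   all blocks. *)
have MRx d : size d = a -> halts_with M (pair_code x d) T (R x d).
  move=> sd; apply: decides_le (MR x d); apply: horner_nat_le.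
  by rewrite size_cat /= !size_map sd; lia.
have leN : (size x).+1 + a + c.+1 <= N by lia.
apply: decides_le (@Next_decides M R x a c N T MRx leN _ [::] _ _ _ _ _ _ isT).
rewrite /block_time -/T; set G := 12 * _.
(* There are [a + c.+1 <= N] rounds; the extra [G] pays for copying [x], the header and the tail. *)
have -> : N.+1 * G = N * G + G by rewrite mulSn addnC.
have : (a + c.+1) * G <= N * G by rewrite leq_mul2r; apply/orP; right; lia.
by rewrite /G; lia.
Qed.

Lemma check_polytime : polytime_predicate (check R).
Proof.
exists (verifier M), (('X + 1) * (12%:P * ('X + t + 1)))%R => x y.
rewrite !(hornerM, hornerD, hornerX, hornerC).
by have := verifier_decides x y; rewrite /= -[in _ * _]addn1.
Qed.

End VerifierPolytime.

(** * Counting the accepted strings *)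

(** The most significant bit comes first, so for words of equal length the lexicographic order is
    the order of these numbers. *)
Fixpoint num (d : bitstring) : nat :=
  if d is b :: d' then b * 2 ^ size d' + num d' else 0.

Lemma num_lt d : num d < 2 ^ size d.
Proof. by elim: d => //= -[] d ih; rewrite expnS; lia. Qed.

Lemma num_inj d d' : size d = size d' -> num d = num d' -> d = d'.
Proof.
elim: d d' => [|b d ih] [|b' d'] //= [es].
have := num_lt d; have := num_lt d'; rewrite es.
by case: b; case: b' => /= lt lt' en; try lia; rewrite (ih d') //; lia.
Qed.

Lemma compare_word_Some b p d : compare_word (Some b) p d = Some b.
Proof. by elim: d p => //= b' d ih p; rewrite ih. Qed.

(** By [num_lt], the first differing bit outweighs all later ones. *)
Lemma compare_wordE p d : size p = size d ->
  compare_word None p d = if num p == num d then None else Some (num p < num d).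
Proof.
elim: p d => [|b p ih] [|b' d] //= [es].
have := num_lt p; have := num_lt d; rewrite es; move: (2 ^ size d) => m.
case: b; case: b' => /= lt lt'; rewrite ?compare_word_Some ?mul1n ?mul0n.
- by rewrite ih // eqn_add2l ltn_add2l.
- by rewrite (_ : _ == _ = false) 1?(_ : _ < _ = false) //; lia.
- by rewrite (_ : _ == _ = false) 1?(_ : _ < _ = true) //; lia.
by rewrite ih.
Qed.

(** Strict increase up to some point, then constancy: the order of the blocks in numerical form. *)
Fixpoint climbs (m : nat) (s : seq nat) : bool :=
  if s is n :: s' then
    (m == n) && all (pred1 m) s' || (m < n) && climbs n s'
  else true.

Lemma climbs_min m s : climbs m s -> all (leq m) s.
Proof.
elim: s m => //= n s ih m /orP[/andP[/eqP <- /allP h]|/andP[lt /ih /allP h]].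
  by rewrite leqnn; apply/allP => u /h /eqP ->.
by rewrite (ltnW lt); apply/allP => u /h; apply: leq_trans (ltnW lt).
Qed.

(** Both heads are the minimum of the common set of entries. If one sequence is constant, that set
    is a singleton and the lengths settle the matter. Otherwise both rise at once, the minimum
    occurs in neither tail, and the tails again have the same entries. *)
Lemma climbs_inj m s m' s' : climbs m s -> climbs m' s' -> size s = size s' ->
  m :: s =i m' :: s' -> m :: s = m' :: s'.
Proof.
elim: s m m' s' => [|n s ih] m m' [|n' s'] // cs cs' es e.
  by have := e m; rewrite !inE eqxx => /esym /eqP ->.
have em : m = m'.
  apply/eqP; rewrite eqn_leq; apply/andP; split.
    have : m' \in m :: n :: s by rewrite e mem_head.
    by rewrite inE => /predU1P[->//|]; apply: (allP (climbs_min cs)).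
  have : m \in m' :: n' :: s' by rewrite -e mem_head.
  by rewrite inE => /predU1P[->//|]; apply: (allP (climbs_min cs')).
move: e cs'; rewrite -{m'}em => e cs'.
have const r r' : all (pred1 m) r -> size r = size r' ->
    m :: r =i m :: r' -> r = r'.
  move=> /allP h sr er; have h' : all (pred1 m) r'.
    apply/allP => u ur; have : u \in m :: r by rewrite er inE ur orbT.
    by rewrite inE => /predU1P[->|/h//]; rewrite inE.
  by rewrite (all_pred1P _ _ h') -sr; apply/all_pred1P/allP.
have [c|nc] := boolP (all (pred1 m) (n :: s)).
  by rewrite (const _ _ c es e).
have [c'|nc'] := boolP (all (pred1 m) (n' :: s')).
  by rewrite (const _ _ c' (esym es)) // => u; rewrite e.
move: nc nc' (cs) (cs') => /= /negPf nc /negPf nc'.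
rewrite !(eq_sym m) nc nc' /= => /andP[lt cn] /andP[lt' cn'].
congr cons; apply: ih => //; first by case: es.
have neq k r : m < k -> climbs k r -> m \notin k :: r.
  move=> ltk /climbs_min /allP h; rewrite inE negb_or neq_ltn ltk /=.
  by apply/negP => /h; rewrite leqNgt ltk.
move=> u; have [->|um] := eqVneq u m.
  by rewrite (negPf (neq _ _ lt cn)) (negPf (neq _ _ lt' cn')).
by have := e u; rewrite !(in_cons m) (negPf um).
Qed.

Lemma climbs_pad m s k : path ltn m s -> climbs m (s ++ nseq k (last m s)).
Proof.
elim: s m => [|n s ih] m /=; last by move=> /andP[-> /ih ->]; rewrite orbT.
by case: k => //= k _; rewrite eqxx all_pred1_nseq.
Qed.

Definition of_size a : pred bitstring := [pred d | size d == a].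

Lemma climbs_map_num a d ds d' ds' :
    all (of_size a) (d :: ds) -> all (of_size a) (d' :: ds') ->
    climbs (num d) (map num ds) -> climbs (num d') (map num ds') ->
    size ds = size ds' -> d :: ds =i d' :: ds' ->
  d :: ds = d' :: ds'.
Proof.
move=> sz sz' cl cl' es e.
have en : map num (d :: ds) = map num (d' :: ds').
  by apply: climbs_inj; rewrite ?size_map // -!map_cons; apply: eq_mem_map.
elim: (d :: ds) (d' :: ds') sz sz' en => [|u s ih] [|u' s'] //=.
move=> /andP[/eqP su ss] /andP[/eqP su' ss'] [eu es'].
by congr cons; [apply: num_inj eu; rewrite su|apply: ih].
Qed.

Fixpoint chain (prev : bitstring) (e : bool) (ds : seq bitstring) : bool :=
  if ds is d :: ds' then
    let o := compare_word None prev d in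
    in_order e o && chain d (~~ isSome o) ds'
  else true.

Lemma chain_equal a d ds : size d = a -> all (of_size a) ds ->
  chain d true ds = all (pred1 (num d)) (map num ds).
Proof.
elim: ds d => //= d' ds ih d sd /andP[/eqP sd' sds].
rewrite compare_wordE ?sd ?sd' //; case: eqVneq => [en|ne] /=.
  by rewrite ih // en.
by rewrite andbF.
Qed.

Lemma chain_climbs a d ds : size d = a -> all (of_size a) ds ->
  chain d false ds = climbs (num d) (map num ds).
Proof.
elim: ds d => //= d' ds ih d sd /andP[/eqP sd' sds].
rewrite compare_wordE ?sd ?sd' //; case: eqVneq => [en|ne] /=.
  by rewrite (chain_equal sd') // en ltnn /= orbF.
by rewrite andbT (ih d').
Qed.

(** A nonempty first block counts as larger than the empty word and leaves the flag down. For
    [a = 0] the flag is raised at once, but then all blocks are empty and hence equal. *)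
Lemma chain_start a d ds : size d = a -> all (of_size a) ds ->
  chain [::] false (d :: ds) = climbs (num d) (map num ds).
Proof.
case: d => [|b d] sd sds /=; last first.
  by rewrite compare_word_Some /=; apply: chain_climbs sds.
rewrite (chain_equal sd sds) /=; move: sds; rewrite -sd.
by case: ds => //= d ds /andP[/nilP -> _] /=; rewrite orbF.
Qed.

(** * Strings that encode lists of blocks *)

Definition body a c (ds : seq bitstring) : bitstring :=
  flatten [seq d ++ nseq c false | d <- ds] ++ nseq a false.

Definition encoding a c (ds : seq bitstring) : bitstring :=
  nseq a true ++ nseq c false ++ true :: body a c ds.

Lemma body_cons a c d ds :
  body a c (d :: ds) = d ++ nseq c false ++ body a c ds.
Proof. by rewrite /body /= -!catA. Qed.

Lemma size_body a c ds : all (of_size a) ds ->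
  size (body a c ds) = size ds * (a + c) + a.
Proof.
elim: ds => [|d ds ih] /=; first by rewrite size_nseq.
case/andP=> /eqP sd sds; rewrite body_cons 2!size_cat size_nseq sd ih // mulSn.
by lia.
Qed.

Lemma body_inj a c ds ds' : all (of_size a) ds -> all (of_size a) ds' ->
  size ds = size ds' -> body a c ds = body a c ds' -> ds = ds'.
Proof.
elim: ds ds' => [|d ds ih] [|d' ds'] //=.
move=> /andP[/eqP sd sds] /andP[/eqP sd' sds'] [es].
rewrite !body_cons => /eqP; rewrite eqseq_cat ?sd ?sd' // => /andP[/eqP -> ].
by rewrite eqseq_cat // eqxx => /eqP /ih ->.
Qed.

Section Count.
Variables (R : bitstring -> bitstring -> bool) (x : bitstring).

Definition valid a k (ds : seq bitstring) : bool :=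
  [&& size ds == k, all (of_size a) ds, all (R x) ds & chain [::] false ds].

Lemma check_blocksP a c n prev e z :
  reflect (exists ds, [/\ size ds = n, all (of_size a) ds, all (R x) ds,
                         chain prev e ds & z = body a c ds])
    (check_blocks R x a c n prev e z).
Proof.
elim: n prev e z => [|n ih] prev e z /=.
  by apply: (iffP eqP) => [->|[[|d ds] [] //]]; exists [::].
apply: (iffP and5P) => [[le /eqP ez ord Rd /ih [ds [sn sds Rds cds eb]]]|].
  exists (take a z :: ds); split => //=; rewrite ?sn ?Rd ?ord //.
    by rewrite sds andbT /of_size /= size_take_min; lia.
  by rewrite body_cons -ez -eb !cat_take_drop.
case=> -[[] //|d ds [[sn] /= /andP[/eqP sd sds] /andP[Rd Rds] /andP[ord cds]]].
rewrite body_cons => ->; rewrite take_size_cat // drop_size_cat //.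
rewrite take_size_cat ?drop_size_cat ?size_nseq //; split => //.
  by rewrite size_cat sd leq_addr.
by apply/ih; exists ds.
Qed.

Lemma checkP y :
  reflect (exists a c ds, valid a (a + c.+1) ds /\ y = encoding a c.+1 ds)
    (check R x y).
Proof.
apply: (iffP idP) => [|[a [c [ds [/and4P[/eqP s1 s2 s3 s4] ->]]]]]; last first.
  by rewrite check_header; apply/check_blocksP; exists ds.
case: (headerP y) => [[a ->]|[a [c ->]]|[a [c [z ->]]]].
- by rewrite check_ones.
- by rewrite check_zeros.
rewrite check_header => /check_blocksP [ds [s1 s2 s3 s4 ->]].
by exists a, c, ds; split => //; apply/and4P; split => //; apply/eqP.
Qed.

Definition code_length a c := (a + c) * (a + c) + (a + c) + 1 + a.

Lemma size_encoding a c ds : valid a (a + c) ds ->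
  size (encoding a c ds) = code_length a c.
Proof.
case/and4P=> /eqP sn sds _ _; rewrite !size_cat /= !size_nseq size_body // sn.
by rewrite /code_length; lia.
Qed.

(* [code_length a c] lies between consecutive pronic numbers, so it determines
   [a + c] and then [a]. *)
Lemma code_length_inj a c a' c' :
  code_length a c.+1 = code_length a' c'.+1 -> a = a' /\ c = c'.
Proof.
rewrite /code_length => e; set m := a + c.+1 in e; set m' := a' + c'.+1 in e.
have [lt|lt|em] := ltngtP m m'.
- by have := leq_mul lt lt; rewrite mulSn mulnS /m /m' in e *; lia.
- by have := leq_mul lt lt; rewrite mulSn mulnS /m /m' in e *; lia.
by move: e; rewrite em; rewrite /m /m' in em; lia.
Qed.

(** * Bijection between nonempty witness sets and accepted strings *)

Variables a c : nat.
Let k := a + c.+1.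
Let W : {set a.-tuple bool} := [set w : a.-tuple bool | R x w].
Hypothesis few : #|W| <= c.

Implicit Type S : {set a.-tuple bool}.

Definition listing S : seq bitstring :=
  sort (relpre num leq) [seq val w | w <- enum S].

(** The default of [last] is reached only for the empty set, which the counting excludes. *)
Definition padded S : seq bitstring :=
  listing S ++ nseq (k - #|S|) (last [::] (listing S)).

Lemma mem_listing S (w : a.-tuple bool) : (val w \in listing S) = (w \in S).
Proof. by rewrite mem_sort mem_map ?mem_enum //; apply: val_inj. Qed.

Lemma size_listing S : size (listing S) = #|S|.
Proof. by rewrite size_sort size_map cardE. Qed.

Lemma listing_of_size S : all (of_size a) (listing S).
Proof.
rewrite all_sort; apply/allP => _ /mapP[w _ ->].
by rewrite /of_size /= size_tuple.
Qed.

Lemma listing_sorted S : sorted ltn (map num (listing S)).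
Proof.
rewrite ltn_sorted_uniq_leq; apply/andP; split.
  rewrite map_inj_in_uniq ?sort_uniq ?map_inj_uniq ?enum_uniq //.
    exact: val_inj.
  have /allP sz := listing_of_size S; move=> d d' /sz/eqP sd /sz/eqP sd'.
  by apply: num_inj; rewrite sd.
rewrite sorted_map; apply: sort_sorted => d d'; exact: leq_total.
Qed.

Lemma mem_padded S : S != set0 -> padded S =i listing S.
Proof.
rewrite -card_gt0 -size_listing => s0 d; rewrite mem_cat mem_nseq.
case: (listing S) s0 => // d0 ds _; apply/orP/idP => [[//|/andP[_ /eqP ->]]|h].
  exact: (mem_last d0 ds).
by left.
Qed.

Lemma valid_padded S : S != set0 -> S \subset W -> valid a k (padded S).
Proof.
move=> s0 sW; have cS : #|S| <= c := leq_trans (subset_leq_card sW) few.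
have sz : all (of_size a) (padded S).
  by apply/allP => d; rewrite mem_padded //; apply: (allP (listing_of_size S)).
apply/and4P; split => //.
- by rewrite size_cat size_nseq size_listing /k; lia.
- apply/allP => d; rewrite mem_padded // mem_sort => /mapP[w].
  by rewrite mem_enum => /(subsetP sW); rewrite inE => Rw ->.
move: sz (listing_sorted S); rewrite /padded.
case E: (listing S) => [|d ds].
  by move: s0; rewrite -card_gt0 -size_listing E.
move=> /= /andP[/eqP sd sds] ls.
rewrite -/(chain [::] false (d :: _)) (chain_start sd sds).
rewrite map_cat map_nseq -last_map.
exact: climbs_pad.
Qed.

(** Take for [S] the set of all blocks in [ds]. Then [padded S] and [ds] are valid lists of the same
    length with the same elements, so [climbs_map_num] identifies them; [k > 0] makes them
    nonempty. *)
Lemma padded_support ds : valid a k ds ->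
  exists S, [/\ S != set0, S \subset W & padded S = ds].
Proof.
move=> v; pose S := [set w : a.-tuple bool | val w \in ds].
case/and4P: (v) => /eqP sn sds Rds cds.
have tup d : d \in ds -> {w : a.-tuple bool | val w = d}.
  by move=> /(allP sds) sd; exists (Tuple sd).
have S0 : S != set0.
  case: ds @S v sn sds Rds cds tup => [|d ds] S v sn sds Rds cds tup.
    by rewrite /k addnS in sn.
  have [w ew] := tup d (mem_head _ _).
  by apply/set0Pn; exists w; rewrite inE ew mem_head.
have SW : S \subset W.
  by apply/subsetP => w; rewrite !inE => /(allP Rds).
exists S; split => //.
have mem : padded S =i ds.
  move=> d; rewrite mem_padded //; apply/idP/idP => [|dds].
    by rewrite mem_sort => /mapP[w]; rewrite mem_enum inE => h ->.
  by have [w ew] := tup d dds; rewrite -ew mem_listing inE ew.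
case/and4P: (valid_padded S0 SW) => /eqP sp szp _ cp.
case E : (padded S) sp szp cp mem => [|d' ds'] sp szp cp mem.
  by rewrite /k addnS in sp.
case: ds {v S0 SW S E tup Rds} sn sds cds mem => [|d ds] sn sds cds mem.
  by rewrite /k addnS in sn.
have /= /andP[/eqP sd' sds'] := szp; have /= /andP[/eqP sd sds1] := sds.
apply: (climbs_map_num szp sds) => //.
- by rewrite -(chain_start sd' sds').
- by rewrite -(chain_start sd sds1).
by case: sn sp => <- /= [].
Qed.

Let len := code_length a c.+1.

Definition subset_code S : len.-tuple bool :=
  insubd [tuple of nseq len false] (encoding a c.+1 (padded S)).

Lemma val_subset_code S : S != set0 -> S \subset W ->
  val (subset_code S) = encoding a c.+1 (padded S).
Proof.
by move=> S0 SW; rewrite val_insubd size_encoding ?eqxx //; apply: valid_padded.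
Qed.

Lemma subset_code_inj : {in powerset W :\ set0 &, injective subset_code}.
Proof.
move=> S S'; rewrite !inE => /andP[S0 SW] /andP[S0' SW'] /(congr1 val).
rewrite !val_subset_code // => /eqP; rewrite !eqseq_cat // !eqxx /=.
rewrite eqseq_cons eqxx => /eqP eb.
have [/and4P[/eqP s1 s2 _ _] /and4P[/eqP s1' s2' _ _]] :=
  (valid_padded S0 SW, valid_padded S0' SW').
have ep : padded S = padded S' by apply: body_inj eb; rewrite ?s1 ?s1'.
by apply/setP => w; rewrite -!mem_listing -!mem_padded // ep.
Qed.

(** The length of an accepted string forces its header to carry exactly [a] and [c.+1];
    [padded_support] then recognizes its blocks as a padded set. *)
Lemma subset_code_image :
  subset_code @: (powerset W :\ set0) = [set y : len.-tuple bool | check R x y].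
Proof.
apply/setP => y; rewrite inE; apply/imsetP/checkP => [[S]|].
  rewrite !inE => /andP[S0 SW] ->; exists a, c, (padded S).
  by rewrite val_subset_code //; split => //; apply: valid_padded.
case=> a' [c' [ds [v ey]]].
have [ea ec] : a = a' /\ c = c'.
  by apply: code_length_inj; rewrite -(size_encoding v) -ey size_tuple.
rewrite -{a'}ea -{c'}ec in v ey; have [S [S0 SW eS]] := padded_support v.
exists S; first by rewrite !inE S0 SW.
by apply: val_inj; rewrite val_subset_code // eS.
Qed.

Lemma card_check :
  #|[set y : len.-tuple bool | check R x y]| = 2 ^ #|W| - 1.
Proof.
rewrite -subset_code_image card_in_imset; last exact: subset_code_inj.
by rewrite -card_powerset (cardsD1 set0 (powerset W)) inE sub0set addKn.
Qed.

End Count.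

Theorem theorem2 (L : language) : FewP L -> MNP L.
Proof.
case=> p [q [R [[M [t MR]] few]]].
(* The number of blocks, for [a = p(|x|)] and [c = q(|x|) + 1]. *)
pose k : {poly nat} := (p + (q + 1))%R.
exists (k * k + k + 1 + p)%R, (check R); split; first exact: check_polytime MR.
move=> x; have [inL ninL] := few x.
(* Covers both cases: outside [L] the number of witnesses is 0, which meets the bound and gives
   [2 ^ 0 - 1 = 0]. *)
have count : num_witnesses p R x <= q.[size x]%R ->
    num_witnesses (k * k + k + 1 + p)%R (check R) x =
    2 ^ num_witnesses p R x - 1.
  rewrite /num_witnesses.
  have -> : ((k * k + k + 1 + p).[size x] =
             code_length p.[size x] (q.[size x] : nat).+1)%R.
    by rewrite /k !(hornerM, hornerD, hornerC) /code_length -[_.+1]addn1.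
  exact: card_check.
split=> [/inL /andP[pos le]|/ninL zero].
  by exists (num_witnesses p R x); rewrite ?count.
by rewrite count zero.
Qed.
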